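(* For each $u\in C(\mathbb{T}^n,\mathbb{R})$, there is a constant $K>0$ such that \[ \|T^a_tu-\bar{u}\|_\infty\leq\frac{K}{t}, \quad \forall t>0, \] where $\bar u=\lim_{t\to+\infty}T^a_tu$ and $K$ depends only on $n$ and $u$.
   Context: $\mathbb{T}^n=\mathbb{R}^n/\mathbb{Z}^n$ is the flat torus and $\mathbb{S}^{n-1}$ is the unit sphere in $\mathbb{R}^n$. Consider the class of $C^2$ positive definite and superlinear Lagrangians on $\mathbb{T}^n$ \[ L^1_a(x,v)=\frac12\langle A(x)(v-\omega),(v-\omega)\rangle+f(x,v-\omega),\quad x\in\mathbb{T}^n,\ v\in\mathbb{R}^n, \] where $A(x)$ is an $n\times n$ matrix, $\omega\in\mathbb{S}^{n-1}$ is a given vector, and $f(x,v-\omega)=O(\|v-\omega\|^3)$ as $v-\omega\to0$. Positive definite means that the Hessian $\partial^2L^1_a/\partial v^2(x,v)$ is positive definite for every $(x,v)$; superlinear means that $L^1_a(x,v)/\|v\|\to+\infty$ as $\|v\|\to+\infty$, uniformly in $x$. The Lax-Oleinik semigroup associated with $L^1_a$ is defined, for $u\in C(\mathbb{T}^n,\mathbb{R})$, $t\ge0$, $x\in\mathbb{T}^n$, by \[ T^a_tu(x)=\inf_\gamma\Big\{u(\gamma(0))+\int_0^tL^1_a(\gamma(s),\dot\gamma(s))\,ds\Big\}, \] the infimum being taken over continuous and piecewise $C^1$ paths $\gamma:[0,t]\to\mathbb{T}^n$ with $\gamma(t)=x$. The Mañé critical value $c(L^1_a)$, i.e. the unique constant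 $c$ for which the semigroup $u\mapsto T^a_tu+ct$, $t\ge0$, has a fixed point in $C(\mathbb{T}^n,\mathbb{R})$, equals $0$ for these Lagrangians, and for every $u\in C(\mathbb{T}^n,\mathbb{R})$ the uniform limit $\bar u=\lim_{t\to+\infty}T^a_tu$ exists (Fathi). $\|\cdot\|_\infty$ is the supremum norm.
   Formalization: K may depend on the Lagrangian data A and f as well as on n and u (but not on ω): a K depending only on n and u fails for n=1, f=0, constant A=a→∞, where T_m u→u at integer times m while ū=min u. *)

(* Defs.v *)
From HB Require Import structures.
From mathcomp Require Import all_boot all_order all_algebra.
From mathcomp Require Import all_classical all_reals all_analysis.

Set Implicit Arguments.
Unset Strict Implicit.
Unset Printing Implicit Defensive.

Import Order.TTheory GRing.Theory Num.Theory.
Import numFieldNormedType.Exports.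

Local Open Scope classical_set_scope.
Local Open Scope ring_scope.

(* Objects on the flat torus R^n/Z^n are represented on the universal cover
   R^n: functions of x in the torus are Z^n-periodic functions of x : 'rV[R]_n,
   and curves in the torus are represented by their lifts to R^n. *)
Definition Zperiodic (R : realType) (n : nat) (T : Type) (g : 'rV[R]_n -> T) :=
  forall (x : 'rV[R]_n) (k : 'rV[int]_n), g (x + map_mx intr k) = g x.

Definition torus_continuous (R : realType) (n : nat) (u : 'rV[R]_n -> R) :=
  continuous u /\ Zperiodic u.

(* The library norm on 'rV[R]_n is the max norm, hence the Euclidean one here. *)
Definition dotrv (R : realType) (n : nat) (v w : 'rV[R]_n) : R :=
  (v *m w^T) 0 0.

Definition enorm (R : realType) (n : nat) (v : 'rV[R]_n) : R :=
  Num.sqrt (dotrv v v).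

Definition class_C1 (R : realType) (V : normedModType R) (F : V -> R) :=
  (forall p, differentiable F p) /\
  (forall h, continuous (fun p => 'd F p h)).

Definition class_C2 (R : realType) (V : normedModType R) (F : V -> R) :=
  class_C1 F /\ (forall h, class_C1 (fun p => 'd F p h)).

Definition hessian (R : realType) (n : nat) (g : 'rV[R]_n -> R) (v : 'rV[R]_n)
    : 'M[R]_n :=
  \matrix_(i, j) 'D_(delta_mx 0 i) (fun w => 'D_(delta_mx 0 j) g w) v.

Definition posdefmx (R : realType) (n : nat) (H : 'M[R]_n) :=
  forall y : 'rV[R]_n, y != 0 -> 0 < dotrv (y *m H) y.

Definition positive_definite (R : realType) (n : nat)
    (L : 'rV[R]_n -> 'rV[R]_n -> R) :=
  forall x v, posdefmx (hessian (L x) v).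

Definition superlinear (R : realType) (n : nat)
    (L : 'rV[R]_n -> 'rV[R]_n -> R) :=
  forall M : R, exists rho : R,
    forall x v, rho < enorm v -> M <= L x v / enorm v.

(* Vectors are rows, so A(x) w is written w *m (A x)^T. *)
Definition L1a (R : realType) (n : nat) (A : 'rV[R]_n -> 'M[R]_n)
    (f : 'rV[R]_n -> 'rV[R]_n -> R) (omega x v : 'rV[R]_n) : R :=
  2^-1 * dotrv ((v - omega) *m (A x)^T) (v - omega) + f x (v - omega).

(* gamma, continuous on [a, b], is C^1 on [a, b] (one-sided at the end points):
   its derivative exists and is continuous on ]a, b[, with limits at a and b. *)
Definition C1_piece (R : realType) (n : nat) (gamma : R -> 'rV[R]_n) (a b : R) :=
  [/\ forall s, a < s < b -> derivable gamma s 1,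
      forall s, a < s < b -> {for s, continuous (derive1 gamma)},
      cvg (derive1 gamma s @[s --> a^'+]) &
      cvg (derive1 gamma s @[s --> b^'-])].

Definition piecewise_C1 (R : realType) (n : nat) (t : R)
    (gamma : R -> 'rV[R]_n) :=
  {within `[0, t], continuous gamma} /\
  exists2 s : seq R, itv_partition 0 t s &
    forall i, (i < size s)%N -> C1_piece gamma (nth 0 (0 :: s) i) (nth 0 s i).

(* The values of derive1 gamma at the finitely many break points are irrelevant. *)
Definition action (R : realType) (n : nat) (L : 'rV[R]_n -> 'rV[R]_n -> R)
    (t : R) (gamma : R -> 'rV[R]_n) : \bar R :=
  (\int[@lebesgue_measure R]_(s in `[0%R, t]) (L (gamma s) (derive1 gamma s))%:E)%E.

(* The infimum is taken in the extended reals, so that it needs no side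
   condition to be meaningful. *)
Definition lax_oleinik (R : realType) (n : nat)
    (L : 'rV[R]_n -> 'rV[R]_n -> R) (t : R) (u : 'rV[R]_n -> R)
    (x : 'rV[R]_n) : \bar R :=
  ereal_inf [set ((u (gamma 0))%:E + action L t gamma)%E | gamma in
    [set gamma : R -> 'rV[R]_n | piecewise_C1 t gamma /\ gamma t = x]].

Definition supnorm (R : realType) (n : nat) (g : 'rV[R]_n -> \bar R) : \bar R :=
  ereal_sup [set `|g x|%E | x in [set: 'rV[R]_n]].

(* Main.v *)
Require Import Defs.
From HB Require Import structures.
From mathcomp Require Import all_boot all_order all_algebra.
From mathcomp Require Import all_classical all_reals all_analysis.
From mathcomp Require Import measurable_realfun.
From mathcomp Require Import ring.

(* Since L vanishes to second order along v = omega and is convex in v, we have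
   0 <= L(x, omega + w) <= C |w|^2 for |w| <= 1, with C uniform in x by
   compactness and in omega since L(x, omega + w) does not depend on omega. Hence
   T_t u >= min u. For t >= 1, join a lift of a minimum point of u to x by a
   straight line of velocity omega + y/t with y in the unit cube: its action is at
   most C/t. For t < 1, the line of velocity omega has action 0. So ubar is the
   constant min u. *)

Set Implicit Arguments.
Unset Strict Implicit.
Unset Printing Implicit Defensive.

Import Order.TTheory GRing.Theory Num.Theory.
Import numFieldNormedType.Exports.

Local Open Scope classical_set_scope.
Local Open Scope ring_scope.

(** * Reduction to the compact unit cube *)

(** Subtracting the floor of each coordinate suffices. The cube is taken closed so that compactness
    arguments apply to it. *)
Lemma Zperiodic_representative (R : realType) (n : nat) (x : 'rV[R]_n) :
  exists k : 'rV[int]_n, forall i, 0 <= (x + map_mx intr k) 0 i <= 1.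
Proof.
exists (\row_i - Num.floor (x 0 i)) => i.
rewrite !mxE rmorphN /= subr_ge0 ge_floor lerBlDl -(intrD _ _ 1).
by rewrite ltW // floorD1_gt.
Qed.

Lemma compact_box (R : realType) (n : nat) (l r : 'I_n -> R) :
  compact [set x : 'rV[R]_n | forall i, `[l i, r i]%classic (x ord0 i)].
Proof.
exact: (@rV_compact R n (fun i => `[l i, r i]%classic)
  (fun i => @segment_compact R (l i) (r i))).
Qed.

(** * Mean value and Taylor formulas along a line *)

(** The difference quotient at [s] of the restriction to the line is exactly the quotient of [F] at
    [p + s *: h] in the direction [h]. *)
Lemma is_derive_line (R : realType) (V W : normedModType R) (F : V -> W)
    (p h : V) (s : R) :
  differentiable F (p + s *: h) ->
  is_derive s (1 : R) (fun t : R => F (p + t *: h)) ('d F (p + s *: h) h).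
Proof.
move=> dF.
have E : (fun e : R => e^-1 *: (((fun t => F (p + t *: h)) \o shift s) (e *: 1)
            - F (p + s *: h)))
  = (fun e : R => e^-1 *: ((F \o shift (p + s *: h)) (e *: h) - F (p + s *: h))).
  apply/funext => e /=; congr (_ *: (F _ - _)).
  by rewrite /= scaler1 scalerDl addrCA.
apply: DeriveDef; first by rewrite /derivable E; exact: diff_derivable.
by rewrite /derive E -deriveE.
Qed.

Lemma MVT_line (R : realType) (V : normedModType R) (F : V -> R) (p h : V)
    (a : R) :
  0 < a -> (forall q, differentiable F q) ->
  exists2 c, 0 < c < a & F (p + a *: h) - F p = a * 'd F (p + c *: h) h.
Proof.
move=> a0 dF.
have D (s : R) : is_derive s (1 : R) (fun t : R => F (p + t *: h)) ('d F (p + s *: h) h).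
  exact: is_derive_line.
have [|c] := @MVT R (fun t => F (p + t *: h)) _ _ _ a0 (fun s _ => D s).
  by apply: derivable_within_continuous => s _; have [] := D s.
by rewrite in_itv /= scale0r addr0 subr0 mulrC => ca ->; exists c.
Qed.

(** The mean value theorem is applied to [F] on [0, 1], then to ['d F q h] on [0, c], where the
    value at [p] vanishes. The length c of the second interval stands in place of the usual factor
    1/2; its sign and the bound by 1 are what later estimates use. *)
Lemma taylor2_critical (R : realType) (V : normedModType R) (F : V -> R)
    (p h q : V) :
  class_C2 F -> 'd F p h = 0 -> p + h = q ->
  exists (c d : R) z, [/\ 0 <= c <= 1, 0 <= d <= 1, z = p + d *: h &
    F q = F p + c * 'd (fun q => 'd F q h) z h].
Proof.
move=> [[dF _] /(_ h)[d2F _]] dF0 <-.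
have [c /andP[c0 c1]] := MVT_line p h ltr01 dF.
rewrite scale1r mul1r => Ec.
have [d /andP[d0 dc]] := MVT_line p h c0 d2F.
rewrite dF0 subr0 => Ed; exists c, d, (p + d *: h); split => //.
- by rewrite !ltW.
- by rewrite (ltW d0) (le_trans (ltW dc) (ltW c1)).
- by rewrite -Ed -Ec [RHS]addrC subrK.
Qed.

(** * The Hessian in the velocity as a second differential *)

Lemma derive_snd (R : realType) (U V W : normedModType R) (F : U * V -> W)
    (x : U) (v h : V) :
  differentiable F (x, v) ->
  'D_h (fun w => F (x, w)) v = 'd F (x, v) (0, h).
Proof.
move=> dF; rewrite -(deriveE _ dF) /derive.
have -> // : (fun e : R => e^-1 *: ((F \o shift (x, v)) (e *: (0, h)) - F (x, v)))
  = (fun e : R => e^-1 *: (((fun w => F (x, w)) \o shift v) (e *: h) - F (x, v))).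
apply/funext => e /=; congr (_ *: (F _ - _)).
by rewrite -[LHS]/(_, _) /= scaler0 add0r.
Qed.

(** Linearity is used in both slots: the outer direction is expanded in the differential at [p], the
    inner one in each ['d F q]. *)
Lemma diff2_sum (R : realType) (V : normedModType R) (F : V -> R) (p : V)
    (n : nat) (a : 'I_n -> R) (e : 'I_n -> V) :
  class_C2 F ->
  'd (fun q => 'd F q (\sum_i a i *: e i)) p (\sum_i a i *: e i) =
  \sum_i \sum_j a i * a j * 'd (fun q => 'd F q (e j)) p (e i).
Proof.
move=> [_ d2F]; have D h q : differentiable (fun q => 'd F q h) q.
  by have [] := d2F h.
have E : (fun q => 'd F q (\sum_i a i *: e i)) =
    \sum_j (a j *: (fun q => 'd F q (e j))).
  apply/funext => q; rewrite fct_sumE linear_sum.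
  by apply: eq_bigr => j _; rewrite linearZ.
rewrite linear_sum; apply: eq_bigr => i _.
rewrite linearZ -deriveE // {1}E derive_sum; last first.
  by move=> j; apply: derivableZ; exact: diff_derivable.
rewrite -[LHS]/(a i * _) mulr_sumr; apply: eq_bigr => j _.
rewrite deriveZ; last exact: diff_derivable.
by rewrite deriveE // /GRing.scale /= mulrA.
Qed.

Section partial_hessian.
Context (R : realType) (n : nat) (L : 'rV[R]_n -> 'rV[R]_n -> R).
Let F (p : 'rV[R]_n * 'rV[R]_n) := L p.1 p.2.
Hypothesis F_C2 : class_C2 F.

(** Passing to total differentials of the uncurried Lagrangian gives access to continuity of the
    entries in [x] and [v] jointly. *)
Lemma hessianE x v i j :
  hessian (L x) v i j =
  'd (fun q => 'd F q (0, delta_mx 0 j)) (x, v) (0, delta_mx 0 i).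
Proof.
have [[dF _] d2F] := F_C2.
have -> : hessian (L x) v i j =
    'D_(delta_mx 0 i) (fun w => 'd F (x, w) (0, delta_mx 0 j)) v.
  rewrite mxE; have -> // : (fun w => 'D_(delta_mx 0 j) (L x) w) =
    (fun w => 'd F (x, w) (0, delta_mx 0 j)).
  by apply/funext => w; rewrite -(derive_snd _ (dF _)).
have [/(_ (x, v)) d2Fxv _] := d2F (0, delta_mx 0 j).
exact: derive_snd d2Fxv.
Qed.

Lemma diff2_hessian x v w :
  'd (fun q => 'd F q (0, w)) (x, v) (0, w) =
  \sum_i \sum_j w 0 i * w 0 j * hessian (L x) v i j.
Proof.
have -> : (0 : 'rV[R]_n, w) = \sum_i w 0 i *: (0 : 'rV[R]_n, delta_mx 0 i).
  rewrite {1}[w]row_sum_delta; elim/big_ind2: _ => //.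
    by move=> ? ? ? ? <- <-; rewrite -[RHS]/(_, _) /= addr0.
  by move=> i _; rewrite -[RHS]/(_, _) /= scaler0.
rewrite diff2_sum //; apply: eq_bigr => i _; apply: eq_bigr => j _.
by rewrite hessianE.
Qed.

Lemma dotrv_hessian x v w :
  dotrv (w *m hessian (L x) v) w =
  \sum_i \sum_j w 0 i * w 0 j * hessian (L x) v i j.
Proof.
rewrite /dotrv mxE exchange_big; apply: eq_bigr => j _.
rewrite !mxE mulr_suml; apply: eq_bigr => i _.
by rewrite mulrAC.
Qed.

(** Each entry is a continuous function of [(x, v)], hence bounded on a product of two compact
    boxes. *)
Lemma hessian_locally_bounded (a b : 'I_n -> R) (c d : 'I_n -> R) i j :
  exists2 M : R, 0 <= M & forall x v : 'rV[R]_n,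
    (forall k, a k <= x 0 k <= b k) -> (forall k, c k <= v 0 k <= d k) ->
    `|hessian (L x) v i j| <= M.
Proof.
have [_ d2F] := F_C2.
pose H p := 'd (fun q => 'd F q (0, delta_mx 0 j)) p (0, delta_mx 0 i).
have cH : continuous H by have [_] := d2F (0, delta_mx 0 j); apply.
pose box (l r : 'I_n -> R) :=
  [set x : 'rV[R]_n | forall k, `[l k, r k]%classic (x ord0 k)].
(* Only numbers above [M] are known to be bounds, and [M] may be negative; |M| + 1 exceeds [M] and
   is nonnegative. *)
have /compact_bounded[M [_ /(_ (`|M| + 1))HM]] :
    compact (H @` (box a b `*` box c d)).
  apply: continuous_compact; first exact: continuous_subspaceT.
  exact: compact_setX (@compact_box _ _ a b) (@compact_box _ _ c d).
exists (`|M| + 1) => [|x v xab vcd]; first by rewrite addr_ge0.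
rewrite hessianE; apply: HM.
  by rewrite (le_lt_trans (ler_norm M)) // ltrDl.
by exists (x, v).
Qed.

End partial_hessian.

(** * Quadratic bounds on the Lagrangian near the drift *)

Lemma enormZ (R : realType) (n : nat) (a : R) (w : 'rV[R]_n) :
  enorm (a *: w) = `|a| * enorm w.
Proof.
rewrite /enorm /dotrv -scalemxAl linearZ -scalemxAr scalerA mxE -expr2.
by rewrite sqrtrM ?sqr_ge0 // sqrtr_sqr.
Qed.

Lemma enorm_ge0 (R : realType) (n : nat) (w : 'rV[R]_n) : 0 <= enorm w.
Proof. exact: sqrtr_ge0. Qed.

Section quadratic_bounds.
Context (R : realType) (n : nat) (A : 'rV[R]_n -> 'M[R]_n)
  (f : 'rV[R]_n -> 'rV[R]_n -> R).
Hypothesis f_bigO : forall x : 'rV[R]_n,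
  f x =O_ (0 : 'rV[R]_n) (fun w : 'rV[R]_n => enorm w ^+ 3).

Lemma bigO_cube x : exists2 C : R, 0 <= C &
  \forall w \near (0 : 'rV[R]_n), `|f x w| <= C * enorm w ^+ 3.
Proof.
have /eqO_exP[C [C0 HC]] := f_bigO x; exists C; first exact: ltW.
move: HC; apply: filterS => w /le_trans; apply.
by rewrite ger0_norm // exprn_ge0 ?enorm_ge0.
Qed.

(** An estimate valid near 0 is valid at 0, where the cubic bound vanishes. *)
Lemma bigO_cube0 x : f x 0 = 0.
Proof.
have [C _ /nbhs_singleton] := bigO_cube x.
have := enormZ 0 (0 : 'rV[R]_n); rewrite scale0r normr0 mul0r => ->.
by rewrite expr0n /= mulr0 normr_le0 => /eqP.
Qed.

(** In the variable w = v - omega the Lagrangian is the one with drift 0, whatever [omega] is.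
    Bounds stated for [L1a A f 0] are therefore uniform in the drift. *)
Lemma L1a_translate omega x v : L1a A f omega x v = L1a A f 0 x (v - omega).
Proof. by rewrite /L1a subr0. Qed.

Lemma L1a_origin x : L1a A f 0 x 0 = 0.
Proof. by rewrite /L1a subr0 bigO_cube0 /dotrv mul0mx mul0mx mxE mulr0 addr0. Qed.

Section fixed_drift.
Context (omega : 'rV[R]_n).
Let L := L1a A f omega.
Let F (p : 'rV[R]_n * 'rV[R]_n) := L p.1 p.2.
Hypothesis F_C2 : class_C2 F.

(** Since [L] vanishes at v = omega, the difference quotient with step e is e q + f(x, e w) / e,
    where q is the quadratic part at w. It is at most |e| |q| + C |w|^3 |e|^2 in absolute value,
    which tends to 0. *)
Lemma diff_L1a_drift (x w : 'rV[R]_n) : 'd F (x, omega) (0, w) = 0.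
Proof.
have [[dF _] _] := F_C2.
rewrite -(derive_snd _ (dF _)) /derive; apply: cvg_lim => //.
set q : R := 2^-1 * dotrv (w *m (A x)^T) w.
have [C C0 HC] := bigO_cube x.
have Z : (fun e : R => e *: w) @ 0^' --> (0 : 'rV[R]_n).
  apply: cvg_within_filter; have := @scalel_continuous R 'rV[R]_n w 0.
  by rewrite /continuous_at scale0r.
have U : (fun e : R => `|e| * `|q| + C * enorm w ^+ 3 * (`|e| * `|e|)) @ 0^' --> (0 : R).
  have N : (fun e : R => `|e|) @ 0^' --> (0 : R).
    apply: cvg_within_filter; have := @norm_continuous R R^o 0.
    by rewrite /continuous_at normr0.
  have := cvgD (cvgM N (cvg_cst `|q|))
    (cvgM (cvg_cst (C * enorm w ^+ 3)) (cvgM N N)).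
  rewrite !(mul0r, mulr0) addr0; apply.
apply/norm_cvg0P.
apply: (squeeze_cvgr _ (cvg_cst 0) U).
have e_neq0 : \forall e \near (0 : R)^', e != 0 by exact: nbhs_dnbhs_neq.
apply: filterS2 e_neq0 (Z _ HC) => e e0 He; rewrite normr_ge0 /=.
move: He; rewrite /= enormZ exprMn => He.
have -> : F (x, e *: w + omega) - F (x, omega) = e * e * q + f x (e *: w).
  rewrite /F /L /= !(L1a_translate omega) addrK subrr L1a_origin subr0 /L1a subr0.
  congr (_ + _); rewrite /q /dotrv linearZ -scalemxAl -scalemxAl -scalemxAr.
  by rewrite scalerA mxE mulrCA.
clearbody q; rewrite scalerDr; apply: (le_trans (ler_normD _ _)); apply: lerD.
  by rewrite /GRing.scale /= !mulrA mulVf // mul1r normrM lexx.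
rewrite /GRing.scale /= normrM normfV.
rewrite ler_pdivrMl ?normr_gt0 //.
apply: le_trans He _.
move: (enorm w) `|e| => a b; rewrite le_eqVlt; apply/orP; left; apply/eqP; ring.
Qed.

(** Value and velocity derivative both vanish at v = omega, so only the second-order term
    survives. *)
Lemma L1a_taylor x w : exists c d : R, [/\ 0 <= c <= 1, 0 <= d <= 1 &
  L1a A f 0 x w = c * dotrv (w *m hessian (L x) (omega + d *: w)) w].
Proof.
have E : (x, omega) + (0, w) = (x, omega + w) :> 'rV[R]_n * 'rV[R]_n.
  by rewrite -[LHS]/(_, _) /= addr0.
have [c [d [z [c01 d01 zE FE]]]] :=
  taylor2_critical F_C2 (diff_L1a_drift x w) E.
have {}zE : z = (x, omega + d *: w).
  by rewrite zE -[LHS]/(_, _) /= scaler0 addr0.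
exists c, d; split => //; move: FE; rewrite zE diff2_hessian // -dotrv_hessian.
rewrite {1 2}/F /= /L !(L1a_translate omega) subrr L1a_origin add0r.
by rewrite (addrC omega) addrK.
Qed.

Lemma L1a_ge0 x w : positive_definite L -> 0 <= L1a A f 0 x w.
Proof.
move=> posL; have [c [d [/andP[c0 _] _ ->]]] := L1a_taylor x w.
(* Positive definiteness speaks of nonzero vectors only, so w = 0 is treated apart. *)
apply: mulr_ge0 => //; have [->|w0] := eqVneq w 0.
  by rewrite /dotrv trmx0 mulmx0 mxE.
by apply/ltW/posL.
Qed.

(** By periodicity [x] may be moved into the unit cube, and r <= 1 keeps the intermediate velocity
    within 1 of [omega] in each coordinate. The Hessian entries are bounded there, and [C] is the
    sum of these bounds. The case r = 0 is allowed and is used for the velocity [omega] itself. *)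
Lemma L1a_quadratic_upper_bound : Zperiodic A -> Zperiodic f ->
  exists2 C : R, 0 <= C & forall (x w : 'rV[R]_n) (r : R), r <= 1 ->
    (forall i, `|w 0 i| <= r) -> L1a A f 0 x w <= C * r ^+ 2.
Proof.
move=> perA perf.
have M i j : {M : R | 0 <= M & forall x v : 'rV[R]_n,
    (forall k, 0 <= x 0 k <= 1) ->
    (forall k, omega 0 k - 1 <= v 0 k <= omega 0 k + 1) ->
    `|hessian (L x) v i j| <= M}.
  by apply: cid2; exact: hessian_locally_bounded.
exists (\sum_i \sum_j s2val (M i j)) => [|x w r r1 wr].
  by apply: sumr_ge0 => i _; apply: sumr_ge0 => j _; case: (M i j).
have [k xk] := Zperiodic_representative x.
have -> : L1a A f 0 x w = L1a A f 0 (x + map_mx intr k) w.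
  by rewrite /L1a perA perf.
have [c [d [/andP[c0 c1] /andP[d0 d1] ->]]] := L1a_taylor (x + map_mx intr k) w.
(* The sign of [r] is read off a coordinate of [w], hence the index argument. *)
have rge0 (i : 'I_n) : 0 <= r by exact: le_trans (normr_ge0 _) (wr i).
rewrite dotrv_hessian; apply: (le_trans (ler_norm _)).
rewrite normrM (ger0_norm c0); apply: (le_trans (ler_piMl (normr_ge0 _) c1)).
apply: (le_trans (ler_norm_sum _ _ _)); rewrite mulr_suml; apply: ler_sum => i _.
apply: (le_trans (ler_norm_sum _ _ _)); rewrite mulr_suml; apply: ler_sum => j _.
rewrite !normrM mulrC; apply: ler_pM => //; last first.
  by rewrite expr2; apply: ler_pM.
case: (M i j) => /= m _; apply => // l.
have : `|d * w 0 l| <= 1.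
  rewrite normrM (ger0_norm d0); apply: (le_trans (ler_piMl (normr_ge0 _) d1)).
  exact: le_trans (wr l) r1.
by rewrite !mxE ler_norml => /andP[? ?]; rewrite !lerD2l; apply/andP; split.
Qed.

(** The function is the differentiable [F] restricted to a line along which the velocity stays
    [omega + w]. This serves the measurability of the action integrand. *)
Lemma L1a_line_continuous (p v w : 'rV[R]_n) :
  continuous (fun s : R => L1a A f 0 (p + s *: v) w).
Proof.
have [[dF _] _] := F_C2 => s.
have -> : (fun s : R => L1a A f 0 (p + s *: v) w) =
    (fun s => F ((p, omega + w) + s *: (v, 0))).
  apply/funext => t; rewrite /F /L [RHS](L1a_translate omega).
  rewrite -[in RHS]/((_, _) : _ * _) /= scaler0 addr0 addrAC subrr.
  by rewrite add0r.
apply: differentiable_continuous; apply/derivable1_diffP.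
by have [] := is_derive_line (dF ((p, omega + w) + s *: (v, 0))).
Qed.

End fixed_drift.
End quadratic_bounds.

(** * Extrema of a continuous function on the torus *)

Lemma torus_continuous_extrema (R : realType) (n : nat) (u : 'rV[R]_n -> R) :
  torus_continuous u -> exists a b, forall x, u a <= u x <= u b.
Proof.
move=> [cu pu]; pose B := [set x : 'rV[R]_n | forall i, `[0, 1]%classic (x ord0 i)].
have B0 : B !=set0 by exists 0 => i /=; rewrite mxE in_itv /= lexx ler01.
have cuB : {within B, continuous u} by exact: continuous_subspaceT.
have [a _ ua] := compact_EVT_min B0 (@compact_box R n (cst 0) (cst 1)) cuB.
have [b _ ub] := compact_EVT_max B0 (@compact_box R n (cst 0) (cst 1)) cuB.
exists a, b => x; have [k xk] := Zperiodic_representative x.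
rewrite -(pu x k) ua ?ub //; apply/mem_set => i /=; rewrite in_itv /=; exact: xk.
Qed.

(** * Bounds on the Lax-Oleinik semigroup, with straight lines as test curves *)

Section lines.
Context (R : realType) (n : nat) (L : 'rV[R]_n -> 'rV[R]_n -> R).

Lemma derive1_line (p v : 'rV[R]_n) (s : R) :
  derivable (fun s : R => p + s *: v) s 1 /\
  derive1 (fun s : R => p + s *: v) s = v.
Proof.
have D : is_derive s (1 : R) (fun t : R => p + t *: v) ('d id (p + s *: v) v).
  by apply: (is_derive_line (F := id)).
by split; [case: D | rewrite derive1E derive_val -deriveE // derive_id].
Qed.

Lemma piecewise_C1_line (p v : 'rV[R]_n) (t : R) :
  0 < t -> piecewise_C1 t (fun s : R => p + s *: v).
Proof.
move=> t0; split.
  apply: derivable_within_continuous => s _; by have [] := derive1_line p v s.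
have E : derive1 (fun s : R => p + s *: v) = cst v.
  by apply/funext => s; exact: (derive1_line p v s).2.
exists [:: t]; first exact: itv_partition1.
move=> [|//] _ /=; rewrite /C1_piece E; split=> [s _|s _| |].
- by have [] := derive1_line p v s.
- exact: cst_continuous.
- exact: is_cvg_cst.
- exact: is_cvg_cst.
Qed.

Hypothesis L_ge0 : forall x v, 0 <= L x v.

Lemma lax_oleinik_ge (t m : R) (u : 'rV[R]_n -> R) (x : 'rV[R]_n) :
  (forall y, m <= u y) -> (m%:E <= lax_oleinik L t u x)%E.
Proof.
move=> mu; apply: le_ereal_inf_tmp => _ [gamma _ <-].
rewrite -[leLHS]adde0; apply: leeD; first by rewrite lee_fin.
by apply: integral_ge0 => s _; rewrite lee_fin.
Qed.

(** The test curve has constant velocity [v] and reaches [x] at time [t], so it starts at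
    [x - t *: v]; its action is at most c t. *)
Lemma lax_oleinik_le_line (t c : R) (u : 'rV[R]_n -> R) (x v : 'rV[R]_n) :
  0 < t -> (forall p, continuous (fun s : R => L (p + s *: v) v)) ->
  (forall y, L y v <= c) ->
  (lax_oleinik L t u x <= (u (x - t *: v) + c * t)%:E)%E.
Proof.
move=> t0 cL Lc; apply: ge_ereal_inf.
set p := x - t *: v; pose gamma (s : R) := p + s *: v.
exists ((u (gamma 0))%:E + action L t gamma)%E.
  exists gamma => //; split; first exact: piecewise_C1_line.
  by rewrite /gamma /p subrK.
rewrite /gamma scale0r addr0 EFinD; apply: leeD => //.
rewrite /action; apply: (@le_trans _ _
  (\int[@lebesgue_measure R]_(s in `[0%R, t]) c%:E)%E); last first.
  by rewrite integral_cst //= lebesgue_measure_itv /= lte_fin t0 sube0.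
apply: (@ge0_le_integral _ _ _ (@lebesgue_measure R)) => //.
- by move=> s _; rewrite lee_fin.
- apply/measurable_EFinP; apply: measurable_funTS.
  apply: continuous_measurable_fun.
  under eq_fun do rewrite (derive1_line p v _).2.
  exact: cL.
- by move=> s _; rewrite lee_fin (derive1_line p v s).2.
Qed.

End lines.

(** * Convergence to the minimum of [u] at rate K / t *)

Theorem theorem1p5 (R : realType) (n : nat) (n_gt0 : (0 < n)%N)
    (A : 'rV[R]_n -> 'M[R]_n) (f : 'rV[R]_n -> 'rV[R]_n -> R)
    (A_periodic : Zperiodic A) (f_periodic : Zperiodic f)
    (f_bigO : forall x : 'rV[R]_n,
       f x =O_ (0 : 'rV[R]_n) (fun w : 'rV[R]_n => enorm w ^+ 3))
    (u : 'rV[R]_n -> R) (u_cont : torus_continuous u) :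
  exists2 K : R, 0 < K &
    forall omega : 'rV[R]_n, enorm omega = 1 ->
      class_C2 (fun p : 'rV[R]_n * 'rV[R]_n => L1a A f omega p.1 p.2) ->
      positive_definite (L1a A f omega) ->
      superlinear (L1a A f omega) ->
      exists ubar : 'rV[R]_n -> R,
        [/\ torus_continuous ubar,
            (supnorm (fun x => lax_oleinik (L1a A f omega) t u x - (ubar x)%:E)%E
               @[t --> +oo%R] --> 0%E) &
            forall t : R, 0 < t ->
              (supnorm (fun x => lax_oleinik (L1a A f omega) t u x - (ubar x)%:E)
                 <= (K / t)%:E)%E].
Proof.
have [a [b uab]] := torus_continuous_extrema u_cont.
have [cu pu] := u_cont.
(* [K] must be chosen before [omega], while the quadratic bound needs a drift with C^2 regularity.
   Any such drift [w0] yields a constant valid for all drifts; if there is none, the claim is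
   vacuous. *)
have [[w0 F_C2]|noL] := pselect (exists omega,
  class_C2 (fun p : 'rV[R]_n * 'rV[R]_n => L1a A f omega p.1 p.2)); last first.
  by exists 1 => // omega _ C2; exfalso; apply: noL; exists omega.
have [C C0 HC] := L1a_quadratic_upper_bound f_bigO F_C2 A_periodic f_periodic.
(* The term 1 makes [K] positive, the oscillation of [u] serves t < 1, and [C] serves t >= 1. *)
pose K := 1 + (u b - u a) + C.
have uba : 0 <= u b - u a by rewrite subr_ge0; have /andP[] := uab b.
exists K => [|omega _ {}F_C2 L_pos _]; first by rewrite !ltr_wpDr.
set L := L1a A f omega.
have L_ge0 x v : 0 <= L x v.
  by rewrite /L L1a_translate; apply: (L1a_ge0 f_bigO F_C2).
have L_cont v p : continuous (fun s : R => L (p + s *: v) v).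
  by under eq_fun do rewrite /L L1a_translate; exact: (L1a_line_continuous F_C2).
have L_le v y r : r <= 1 -> (forall i, `|(v - omega) 0 i| <= r) ->
    L y v <= C * r ^+ 2.
  by rewrite /L L1a_translate; exact: HC.
have T_le t x : 0 < t -> (lax_oleinik L t u x <= (u a + K / t)%:E)%E.
  move=> t0; have [t1|t1] := ltP t 1.
    have Lo y : L y omega <= 0.
      have := L_le omega y 0 ler01; rewrite expr0n /= mulr0; apply => i.
      by rewrite subrr mxE normr0.
    apply: (le_trans (lax_oleinik_le_line L_ge0 u x t0 (L_cont omega) Lo)).
    rewrite mul0r addr0 lee_fin -lerBlDl.
    (* The excess of [u] over its minimum is at most the oscillation, which for t < 1 is at most its
       quotient by t. *)
    have /andP[_ ux] := uab (x - t *: omega).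
    rewrite ler_pdivlMr //; apply: (@le_trans _ _ (u b - u a)).
      apply: (@le_trans _ _ ((u b - u a) * t)).
        by rewrite ler_pM2r // lerD2r.
      by rewrite ler_piMr // ltW.
    by rewrite /K addrAC lerDr addr_ge0.
  (* The vector [y] is congruent to [x - t *: omega - a] modulo the lattice, so the line of velocity
     [v] ending at [x] starts at a lattice translate of [a]. *)
  have [k yk] := Zperiodic_representative (x - t *: omega - a).
  set y := _ + _ in yk; pose v := omega + t^-1 *: y.
  (* The coordinates of [v - omega] lie between 0 and 1/t, which is at most 1; over time t the
     resulting bound integrates to C / t. *)
  have Lv z : L z v <= C * t^-1 ^+ 2.
    apply: L_le; first by rewrite invf_le1.
    move=> i; rewrite /v addrAC subrr add0r mxE; have /andP[y0 y1] := yk i.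
    rewrite ger0_norm; first by rewrite ler_piMr // invr_ge0 ltW.
    by rewrite mulr_ge0 // invr_ge0 ltW.
  apply: (le_trans (lax_oleinik_le_line L_ge0 u x t0 (L_cont v) Lv)).
  have -> : x - t *: v = a + map_mx intr (- k).
    rewrite /v /y scalerDr scalerA mulfV ?gt_eqF // scale1r map_mxN.
    by rewrite opprD addrA (opprD (_ - a)) opprB addrA (addrCA _ a) subrr addr0.
  rewrite pu lee_fin lerD2l expr2 mulrA mulfVK ?gt_eqF //.
  by rewrite ler_pM2r ?invr_gt0 // /K lerDr addr_ge0.
have norm_le t : 0 < t ->
    (supnorm (fun x => lax_oleinik L t u x - (u a)%:E) <= (K / t)%:E)%E.
  move=> t0; apply: ge_ereal_sup => _ [x _ <-].
  have Ta : ((u a)%:E <= lax_oleinik L t u x)%E.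
    by apply: lax_oleinik_ge => // y; have /andP[] := uab y.
  by rewrite gee0_abs ?sube_ge0 // leeBlDl // -EFinD T_le.
exists (cst (u a)); split => //; first by split => // ?; exact: cst_continuous.
apply: (@squeeze_cvge _ _ _ _ (cst 0%E) _ (fun t => (K / t)%:E)).
- near=> t; have t0 : 0 < t by near: t; exact: nbhs_pinfty_gt.
  rewrite norm_le // andbT; apply: (@le_trans _ _ `|lax_oleinik L t u 0 - (u a)%:E|%E).
    exact: abse_ge0.
  (* A supremum of absolute values is nonnegative once the set is nonempty, as the point 0
     witnesses. *)
  by apply: ereal_sup_ubound; exists 0.
- exact: cvg_cst.
- apply: cvg_EFin; first by near=> t.
  have V0 : (fun t : R => t^-1) @ +oo%R --> (0 : R).
    apply/(@gtr0_cvgV0 R R +oo _ id) => //; near=> t; near: t.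
    exact: nbhs_pinfty_gt.
  by have := cvgM (cvg_cst K) V0; rewrite mulr0; apply.
Unshelve. all: by end_near.
Qed.
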